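(* Let $G$ be a locally profinite group, let $H$ be a closed subgroup of $G$, and let $K$ be an open subgroup of $G$. Let $\sigma$ be a smooth representation of $K$ and $\tau$ a smooth representation of $H$, both over a commutative ring $R$ with unit. (1) We have \[ \mathrm{Hom}_{G}(\mathrm{c\text{-}Ind}_{K}^{G}\,\sigma,\ \mathrm{Ind}_{H}^{G}\,\tau) \cong \prod_{g \in K \backslash G / H} \mathrm{Hom}_{K \cap {}^{g}H}(\sigma, {}^{g}\tau). \] (2) Assume moreover that $H \backslash HgK$ is compact for every $g \in G$ and that $\sigma$ is finitely generated as a $K$-representation. Then we also have \[ \mathrm{Hom}_{G}(\mathrm{c\text{-}Ind}_{K}^{G}\,\sigma,\ \mathrm{c\text{-}Ind}_{H}^{G}\,\tau) \cong \bigoplus_{g \in K \backslash G / H} \mathrm{Hom}_{K \cap {}^{g}H}(\sigma, {}^{g}\tau). \]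
   Context: Representations are on $R$-modules, and $\mathrm{Hom}_{G}$ denotes the $R$-module of $R$-linear $G$-equivariant maps (similarly for subgroups). A representation of a topological group is smooth if every vector is fixed by some open subgroup. For a closed subgroup $H$ of a locally profinite group $G$ and a smooth $H$-representation $(\rho, V)$ over $R$, let $\mathrm{IND}_{H}^{G}(\rho)$ be the set of functions $f \colon G \to V$ with $f(hg)=\rho(h)f(g)$ for all $h \in H$, $g \in G$, with $G$ acting by right translation. $\mathrm{Ind}_{H}^{G}\rho$ is the smooth part of $\mathrm{IND}_{H}^{G}(\rho)$ (the vectors fixed by some open subgroup of $G$), and $\mathrm{c\text{-}Ind}_{H}^{G}\rho$ is the subrepresentation of those $f \in \mathrm{Ind}_{H}^{G}\rho$ whose support is compact modulo $H$ (its image in $H\backslash G$ is compact). For $g \in G$, ${}^{g}H := gHg^{-1}$, and ${}^{g}\tau$ is the representation of ${}^{g}H$ on the space of $\tau$ given by ${}^{g}\tau(h') = \tau(g^{-1}h'g)$ for $h' \in {}^{g}H$. In $\mathrm{Hom}_{K \cap {}^{g}H}(\sigma, {}^{g}\tau)$, both $\sigma$ and ${}^{g}\tau$ are restricted to $K \cap {}^{g}H$. In sums and products over $K \backslash G/H$, $g$ runs over a set of representatives of the double cosets. *)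

(* Defs.v *)
From HB Require Import structures.
From mathcomp Require Import all_boot all_algebra.
From mathcomp Require Import all_classical topology.

Set Implicit Arguments.
Unset Strict Implicit.
Unset Printing Implicit Defensive.

Import GRing.Theory.

Local Open Scope classical_set_scope.
Local Open Scope group_scope.
Local Open Scope quotient_scope.

HB.mixin Record isTopologicalGroup G of Topological G & Group G := {
  mulg_continuous : continuous (fun xy : G * G => xy.1 * xy.2);
  invg_continuous : continuous (fun x : G => x^-1)
}.

#[short(type="topologicalGroupType")]
HB.structure Definition TopologicalGroup :=
  {G of Topological G & Group G & isTopologicalGroup G}.

Section Groups.
Variable G : topologicalGroupType.
Implicit Types (H K : groupClosed G) (g x y : G).

(* Openness of U is relative to the subspace topology of L. *)
Definition open_subgroup (L U : {pred G}) : Prop :=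
  [/\ group_closed U, {subset U <= L}
    & open ([set` U] : set (subspace [set` L]))].

Definition locally_profinite : Prop :=
  hausdorff_space G /\
  forall A : set G, nbhs 1 A ->
    exists U : {pred G},
      [/\ group_closed U, open [set` U], compact [set` U] & [set` U] `<=` A].

Definition conj_pred g (L : {pred G}) : {pred G} :=
  [pred x | `[< exists2 h, h \in L & x = g * h * g^-1 >]].

Lemma conj_predP g (L : {pred G}) x :
  reflect (exists2 h, h \in L & x = g * h * g^-1) (x \in conj_pred g L).
Proof. exact: asboolP. Qed.

Definition dcoset (L1 : {pred G}) g (L2 : {pred G}) : set G :=
  [set l1 * g * l2 | l1 in [set` L1] & l2 in [set` L2]].

(* D contains exactly one element of each double coset in L1\G/L2. *)
Definition dcoset_representatives (L1 L2 : {pred G}) (D : {pred G}) : Prop :=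
  forall x, exists! g, g \in D /\ dcoset L1 g L2 x.

Definition rcoset_rel H : rel G := fun x y => x / y \in H.

Lemma rcoset_rel_refl H : reflexive (rcoset_rel H).
Proof. by move=> x; rewrite /rcoset_rel mulgV gpred1. Qed.

Lemma rcoset_rel_sym H : symmetric (rcoset_rel H).
Proof. by move=> x y; rewrite /rcoset_rel -gpredV invgM invgK. Qed.

Lemma rcoset_rel_trans H : transitive (rcoset_rel H).
Proof.
move=> y x z; rewrite /rcoset_rel => xy yz.
have -> : x / z = (x / y) * (y / z) by rewrite mulgA mulgVK.
exact: gpredM.
Qed.

Canonical rcoset_equiv_rel H :=
  EquivRel (rcoset_rel H) (@rcoset_rel_refl H) (@rcoset_rel_sym H)
    (@rcoset_rel_trans H).

(* The space H\G of right cosets Hx with its quotient topology. *)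
Definition rcoset_space H : topologicalType :=
  quotient_topology {eq_quot (rcoset_rel H)}.

Definition to_rcoset H x : rcoset_space H := \pi_({eq_quot (rcoset_rel H)}) x.

Lemma to_rcosetE H x y : (to_rcoset H x = to_rcoset H y) <-> (x / y \in H).
Proof. by split=> [/eqquotP|?]; last exact/eqquotP. Qed.

Lemma to_rcoset_open H (A : set (rcoset_space H)) :
  open A = open (to_rcoset H @^-1` A).
Proof. by []. Qed.


Lemma to_rcoset_continuous H : continuous (to_rcoset H).
Proof. exact: pi_continuous. Qed.

Lemma mulgr_continuous g : continuous (fun x : G => x * g).
Proof.
move=> x; apply: (@continuous_comp _ _ _ (fun y : G => (y, g))
  (fun xy : G * G => xy.1 * xy.2)); last exact: mulg_continuous.
by apply: cvg_pair; [exact: cvg_id | exact: cvg_cst].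
Qed.

Lemma mulgl_continuous g : continuous (fun x : G => g * x).
Proof.
move=> x; apply: (@continuous_comp _ _ _ (fun y : G => (g, y))
  (fun xy : G * G => xy.1 * xy.2)); last exact: mulg_continuous.
by apply: cvg_pair; [exact: cvg_cst | exact: cvg_id].
Qed.

Lemma open_subgroupT (U : {pred G}) :
  open_subgroup predT U <-> group_closed U /\ open [set` U].
Proof.
have oE : open ([set` U] : set (subspace [set` predT])) <-> open [set` U].
  split; last exact: open_subspaceW.
  move=> /open_subspaceP[V oV].
  have -> : [set` predT] = [set: G] by apply/seteqP.
  by rewrite !setIT => <-.
by split=> [[gU _ oU]|[gU oU]]; split=> //; apply/oE.
Qed.

Lemma open_subgroupI (U1 U2 : {pred G}) :
  open_subgroup predT U1 -> open_subgroup predT U2 ->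
  open_subgroup predT [predI U1 & U2].
Proof.
move=> /open_subgroupT[[g1 gF1] o1] /open_subgroupT[[g2 gF2] o2].
apply/open_subgroupT; split.
  split; first by rewrite inE g1 g2.
  by move=> u v /andP[u1 u2] /andP[v1 v2]; rewrite inE gF1 ?gF2.
have -> : [set` [predI U1 & U2]] = [set` U1] `&` [set` U2].
  by apply/seteqP; split=> x /=; [move/andP|move=> ?; apply/andP].
exact: openI.
Qed.

Lemma open_subgroupJ (U : {pred G}) g : open_subgroup predT U ->
  open_subgroup predT (conj_pred g U).
Proof.
move=> /open_subgroupT[[U1 UF] oU]; apply/open_subgroupT; split.
  split; first by apply/conj_predP; exists 1; rewrite ?mulg1 ?mulgV.
  move=> _ _ /conj_predP[u uU ->] /conj_predP[v vU ->]; apply/conj_predP.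
  exists (u / v); first exact: UF.
  by rewrite !invgM invgK !mulgA mulgVK.
have -> : [set` conj_pred g U] = (fun x => g^-1 * x * g) @^-1` [set` U].
  apply/seteqP; split=> x /=.
    by move=> /conj_predP[u uU ->]; rewrite !mulgA mulVg mul1g mulgVK.
  move=> xU; apply/conj_predP; exists (g^-1 * x * g) => //.
  by rewrite !mulgA mulgV mul1g mulgK.
apply: open_comp => // x _.
apply: (@continuous_comp _ _ _ (fun x => g^-1 * x) (fun x => x * g)).
  exact: mulgl_continuous.
exact: mulgr_continuous.
Qed.

End Groups.

Local Open Scope ring_scope.

(* As for mx_repr, only the values of the action on L are meaningful. *)
Record representation (R : comPzRingType) (G : groupType) (L : {pred G}) :=
  Representation {
    rep_module :> lmodType R;
    rep_act : G -> rep_module -> rep_module;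
    rep_linear : forall l, l \in L -> linear (rep_act l);
    rep_act1 : forall v, rep_act 1%g v = v;
    rep_actM : {in L &, forall l m v,
      rep_act (l * m)%g v = rep_act l (rep_act m v)}
  }.

Section Smooth.
Variables (R : comPzRingType) (G : topologicalGroupType) (L : {pred G}).
Variable V : representation R L.

Definition smooth_vector (v : V) : Prop :=
  exists U : {pred G}, open_subgroup L U /\ {in U, forall u, rep_act u v = v}.

Definition smooth : Prop := forall v : V, smooth_vector v.

(* Some finite family lies in no proper subrepresentation. *)
Definition finitely_generated : Prop :=
  exists s : seq V, forall W : {pred V},
    submod_closed W ->
    (forall l w, l \in L -> w \in W -> rep_act l w \in W) ->
    {subset s <= W} -> forall v, v \in W.
End Smooth.

Section Conjugate.
Variables (R : comPzRingType) (G : topologicalGroupType) (L : {pred G}).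
Variables (g : G) (V : representation R L).

Lemma conj_predV (l : G) : l \in conj_pred g L -> (g^-1 * l * g)%g \in L.
Proof.
move=> /conj_predP[u uL ->].
by rewrite !mulgA mulVg mul1g mulgVK.
Qed.

Definition conj_act (l : G) (v : V) : V := rep_act (g^-1 * l * g)%g v.

Lemma conj_act_linear l : l \in conj_pred g L -> linear (conj_act l).
Proof. by move=> /conj_predV /(@rep_linear _ _ _ V). Qed.

Lemma conj_act1 v : conj_act 1%g v = v.
Proof. by rewrite /conj_act mulg1 mulVg rep_act1. Qed.

Lemma conj_actM : {in conj_pred g L &, forall l m v,
  conj_act (l * m)%g v = conj_act l (conj_act m v)}.
Proof.
move=> l m /conj_predV lL /conj_predV mL v; rewrite /conj_act -rep_actM//.
by rewrite !mulgA mulgK.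
Qed.

Definition conj_rep : representation R (conj_pred g L) :=
  Representation conj_act_linear conj_act1 conj_actM.
End Conjugate.

Section Induction.
Variables (R : comPzRingType) (G : topologicalGroupType) (H : groupClosed G).
Variable V : representation R H.
Implicit Types f : G -> V.

Definition right_translate (g : G) f : G -> V := fun x => f (x * g)%g.

Definition IND f : Prop :=
  forall h x, h \in H -> f (h * x)%g = rep_act h (f x).

Definition Ind_pred : {pred G -> V} := [pred f | `[< IND f /\
  exists U : {pred G}, open_subgroup predT U /\
    {in U, forall u, right_translate u f = f} >]].

(* No closure is taken: elements of Ind are locally constant, so their supports
   are closed (support_closed). *)
Definition compact_mod f : Prop :=
  compact (to_rcoset H @` [set x | f x != 0]).

Definition cInd_pred : {pred G -> V} :=
  [pred f | (f \in Ind_pred) && `[< compact_mod f >]].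

Lemma IndP f : reflect (IND f /\
  exists U : {pred G}, open_subgroup predT U /\
    {in U, forall u, right_translate u f = f}) (f \in Ind_pred).
Proof. exact: asboolP. Qed.

Lemma cIndP f : reflect (f \in Ind_pred /\ compact_mod f) (f \in cInd_pred).
Proof. by apply: (iffP andP) => -[? /asboolP]. Qed.

Let rep_act0 h : h \in H -> rep_act h (0 : V) = 0.
Proof.
move=> hH; have := @rep_linear _ _ _ V h hH (-1) 0 0.
by rewrite scaler0 addr0 scaleN1r addNr.
Qed.

Lemma Ind_submod_closed : submod_closed Ind_pred.
Proof.
split.
  apply/IndP; split=> [h x hH|]; first by rewrite rep_act0.
  exists (predT : {pred G}); split; last by [].
  by apply/open_subgroupT; split=> //; rewrite (_ : [set` _] = setT);
    [exact: openT|apply/seteqP].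
move=> a f1 f2 /IndP[I1 [U1 [o1 s1]]] /IndP[I2 [U2 [o2 s2]]].
apply/IndP; split=> [h x hH|].
  by rewrite /= !fctE I1// I2// rep_linear.
exists ([predI U1 & U2] : {pred G}); split; first exact: open_subgroupI.
move=> u /andP[/s1 e1 /s2 e2]; apply/funext => x.
by move/(congr1 (@^~ x)): e1; move/(congr1 (@^~ x)): e2;
  rewrite /right_translate /= !fctE => -> ->.
Qed.

Lemma Ind_right_translate g f :
  f \in Ind_pred -> right_translate g f \in Ind_pred.
Proof.
move=> /IndP[I1 [U [oU sU]]]; apply/IndP; split.
  by move=> h x hH; rewrite /right_translate -mulgA I1.
exists (conj_pred g U); split; first exact: open_subgroupJ.
move=> u /conj_predV /sU e; apply/funext=> x.
move/(congr1 (@^~ (x * g)%g)): e; rewrite /right_translate !mulgA.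
by rewrite mulgK.
Qed.

Lemma support_rcoset f : f \in Ind_pred ->
  to_rcoset H @^-1` (to_rcoset H @` [set x | f x != 0]) = [set x | f x != 0].
Proof.
move=> /IndP[If _]; apply/seteqP; split=> x /=; last by move=> fx; exists x.
move=> [y fy] /to_rcosetE yx; apply: contra_neq fy => fx.
by rewrite -(mulgVK x y) If// fx rep_act0.
Qed.

Lemma support_closed f : f \in Ind_pred ->
  closed (to_rcoset H @` [set x | f x != 0]).
Proof.
move=> fI; rewrite -openC to_rcoset_open -preimage_setC support_rcoset//.
case/IndP: fI => If [U [/open_subgroupT[[U1 UF] oU] sU]].
rewrite openE => x /= /negP; rewrite negbK => /eqP fx0.
rewrite /interior nbhsE; exists ((fun y => x^-1 * y)%g @^-1` [set` U]).
  split; last by rewrite /= mulVg.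
  by apply: open_comp => // y _; exact: mulgl_continuous.
move=> y /= /sU /(congr1 (@^~ x)); rewrite /right_translate mulgA mulgV mul1g.
by move=> ->; rewrite fx0 eqxx.
Qed.

Lemma cInd_submod_closed : submod_closed cInd_pred.
Proof.
have [I0 Ilin] := Ind_submod_closed; split.
  apply/cIndP; split=> //; rewrite /compact_mod.
  rewrite (_ : [set x | _] = set0) ?image_set0; first exact: compact0.
  by apply/seteqP; split=> // x /=; rewrite eqxx.
move=> a f1 f2 /cIndP[I1 c1] /cIndP[I2 c2]; have I12 := Ilin a _ _ I1 I2.
apply/cIndP; split=> //; apply: (subclosed_compact _ (compactU c1 c2)).
  exact: support_closed.
rewrite -image_setU; apply: image_subset => x /=; rewrite !fctE => f12.
have [f1x|?] := eqVneq (f1 x) 0; last by left.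
by right; move: f12; rewrite f1x scaler0 add0r.
Qed.

Lemma cInd_right_translate g f :
  f \in cInd_pred -> right_translate g f \in cInd_pred.
Proof.
move=> /cIndP[If cf]; apply/cIndP; split; first exact: Ind_right_translate.
pose t (q : rcoset_space H) : rcoset_space H :=
  to_rcoset H (repr (q : {eq_quot (rcoset_rel H)}) * g^-1)%g.
have tE x : t (to_rcoset H x) = to_rcoset H (x * g^-1)%g.
  apply/to_rcosetE; rewrite invgM invgK mulgA mulgVK.
  by apply/to_rcosetE; exact: reprK.
have ct : continuous t.
  apply/quotient_continuous.
  rewrite (_ : _ \o _ = fun x => to_rcoset H (x * g^-1)%g); last exact/funext.
  move=> x; apply: (@continuous_comp _ _ _ (fun x => x * g^-1)%g).
    exact: mulgr_continuous.
  exact: to_rcoset_continuous.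
rewrite /compact_mod.
rewrite (_ : _ @` _ = t @` (to_rcoset H @` [set x | f x != 0])); last first.
  rewrite image_comp; apply/seteqP; split=> _ [x /= fx <-].
    by exists (x * g)%g => //=; rewrite tE mulgK.
  by exists (x * g^-1)%g; rewrite /= ?tE// /right_translate mulgVK.
by apply: continuous_compact => //; exact: continuous_subspaceT.
Qed.

HB.instance Definition _ :=
  GRing.isSubmodClosed.Build R (G -> V) Ind_pred Ind_submod_closed.
HB.instance Definition _ :=
  GRing.isSubmodClosed.Build R (G -> V) cInd_pred cInd_submod_closed.

Definition Ind_module := {f : G -> V | f \in Ind_pred}.
HB.instance Definition _ := SubChoice.on Ind_module.
HB.instance Definition _ := [SubChoice_isSubLmodule of Ind_module by <:].

Definition cInd_module := {f : G -> V | f \in cInd_pred}.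
HB.instance Definition _ := SubChoice.on cInd_module.
HB.instance Definition _ := [SubChoice_isSubLmodule of cInd_module by <:].

End Induction.

Section InducedRepresentations.
Variables (R : comPzRingType) (G : topologicalGroupType) (H : groupClosed G).
Variable V : representation R H.

Definition Ind_act (g : G) (f : Ind_module V) : Ind_module V :=
  exist _ (right_translate g (val f)) (Ind_right_translate g (valP f)).

Lemma Ind_act_linear g : g \in predT -> linear (Ind_act g).
Proof. by move=> _ a f1 f2; apply: val_inj. Qed.

Lemma Ind_act1 f : Ind_act 1%g f = f.
Proof.
by apply/val_inj/funext => x; rewrite /= /right_translate mulg1.
Qed.

Lemma Ind_actM : {in predT &, forall g1 g2 f,
  Ind_act (g1 * g2)%g f = Ind_act g1 (Ind_act g2 f)}.
Proof.
move=> g1 g2 _ _ f; apply/val_inj/funext => x.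
by rewrite /= /right_translate mulgA.
Qed.

Definition Ind : representation R (predT : {pred G}) :=
  Representation Ind_act_linear Ind_act1 Ind_actM.

Definition cInd_act (g : G) (f : cInd_module V) : cInd_module V :=
  exist _ (right_translate g (val f)) (cInd_right_translate g (valP f)).

Lemma cInd_act_linear g : g \in predT -> linear (cInd_act g).
Proof. by move=> _ a f1 f2; apply: val_inj. Qed.

Lemma cInd_act1 f : cInd_act 1%g f = f.
Proof.
by apply/val_inj/funext => x; rewrite /= /right_translate mulg1.
Qed.

Lemma cInd_actM : {in predT &, forall g1 g2 f,
  cInd_act (g1 * g2)%g f = cInd_act g1 (cInd_act g2 f)}.
Proof.
move=> g1 g2 _ _ f; apply/val_inj/funext => x.
by rewrite /= /right_translate mulgA.
Qed.

Definition cInd : representation R (predT : {pred G}) :=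
  Representation cInd_act_linear cInd_act1 cInd_actM.
End InducedRepresentations.

Section Restriction.
Variables (R : comPzRingType) (G : groupType) (L M : {pred G}).
Hypothesis sML : {subset M <= L}.
Variable V : representation R L.

Lemma res_linear l : l \in M -> linear (@rep_act R G L V l).
Proof. by move/sML/(@rep_linear _ _ _ V). Qed.

Lemma res_actM : {in M &, forall l m v,
  @rep_act R G L V (l * m)%g v = rep_act l (rep_act m v)}.
Proof. by move=> l m /sML lL /sML mL v; rewrite rep_actM. Qed.

Definition res_rep : representation R M :=
  Representation res_linear (@rep_act1 R G L V) res_actM.
End Restriction.

Section Hom.
Variables (R : comPzRingType) (G : groupType) (L : {pred G}).
Variables V W : representation R L.

Definition Hom_pred : {pred V -> W} := [pred phi : V -> W | `[< linear phi /\
  forall l v, l \in L -> phi (rep_act l v) = rep_act l (phi v) >]].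

Lemma HomP (phi : V -> W) : reflect (linear phi /\
    forall l v, l \in L -> phi (rep_act l v) = rep_act l (phi v))
  (phi \in Hom_pred).
Proof. exact: asboolP. Qed.

Lemma Hom_submod_closed : submod_closed Hom_pred.
Proof.
split.
  apply/HomP; split=> [a u v|l v lL]; first by rewrite /= scaler0 addr0.
  have := @rep_linear _ _ _ W l lL (-1) 0 0.
  by rewrite scaler0 addr0 scaleN1r addNr.
move=> a p q /HomP[pl pL] /HomP[ql qL]; apply/HomP; split.
  move=> b u v; rewrite !fctE pl ql !scalerDr !scalerA [(a * b)%R]mulrC.
  by rewrite addrACA.
by move=> l v lL; rewrite !fctE pL// qL// rep_linear.
Qed.

HB.instance Definition _ :=
  GRing.isSubmodClosed.Build R (V -> W) Hom_pred Hom_submod_closed.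

Definition Hom_module := {phi : V -> W | phi \in Hom_pred}.
HB.instance Definition _ := SubChoice.on Hom_module.
HB.instance Definition _ := [SubChoice_isSubLmodule of Hom_module by <:].
End Hom.

Section ProductSum.
Variables (R : pzRingType) (I : Type) (M : I -> lmodType R).

Definition prod_module := forall i, M i.
HB.instance Definition _ := Choice.on prod_module.

Implicit Types f g h : prod_module.

Let prodD f g : prod_module := fun i => f i + g i.
Let prodN f : prod_module := fun i => - f i.
Let prod0 : prod_module := fun i => 0.
Let prodZ a f : prod_module := fun i => a *: f i.

Let prodDA : associative prodD.
Proof. by move=> f g h; apply/functional_extensionality_dep => i; exact: addrA. Qed.
Let prodDC : commutative prodD.
Proof. by move=> f g; apply/functional_extensionality_dep => i; exact: addrC. Qed.
Let prod0D : left_id prod0 prodD.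
Proof. by move=> f; apply/functional_extensionality_dep => i; exact: add0r. Qed.
Let prodND : left_inverse prod0 prodN prodD.
Proof. by move=> f; apply/functional_extensionality_dep => i; exact: addNr. Qed.

HB.instance Definition _ :=
  GRing.isZmodule.Build prod_module prodDA prodDC prod0D prodND.

Let prodZA a b f : prodZ a (prodZ b f) = prodZ (a * b) f.
Proof. by apply/functional_extensionality_dep => i; exact: scalerA. Qed.
Let prodZ1 : left_id 1 prodZ.
Proof. by move=> f; apply/functional_extensionality_dep => i; exact: scale1r. Qed.
Let prodZDr : right_distributive prodZ +%R.
Proof. by move=> a f g; apply/functional_extensionality_dep => i; exact: scalerDr. Qed.
Let prodZDl f : {morph prodZ^~ f : a b / a + b}.
Proof. by move=> a b; apply/functional_extensionality_dep => i; exact: scalerDl. Qed.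

HB.instance Definition _ := GRing.Zmodule_isLmodule.Build R prod_module
  prodZA prodZ1 prodZDr prodZDl.

Lemma prod_moduleD f g i : (f + g) i = f i + g i. Proof. by []. Qed.
Lemma prod_module0 i : (0 : prod_module) i = 0. Proof. by []. Qed.
Lemma prod_moduleZ a f i : (a *: f) i = a *: f i. Proof. by []. Qed.

Definition sum_pred : {pred prod_module} :=
  [pred f : prod_module | `[< finite_set [set i | f i != 0] >]].

Lemma sum_submod_closed : submod_closed sum_pred.
Proof.
split.
  apply/asboolP; rewrite (_ : [set i | _] = set0); first exact: finite_set0.
  by apply/seteqP; split=> // i /=; rewrite eqxx.
move=> a f g /asboolP ff /asboolP fg; apply/asboolP.
have ffg : finite_set ([set i | f i != 0] `|` [set i | g i != 0]).
  by rewrite finite_setU.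
apply: (sub_finite_set _ ffg) => i /=; rewrite prod_moduleD prod_moduleZ => fgi.
have [fi|?] := eqVneq (f i) 0; last by left.
by right; move: fgi; rewrite fi scaler0 add0r.
Qed.

HB.instance Definition _ :=
  GRing.isSubmodClosed.Build R prod_module sum_pred sum_submod_closed.

Definition sum_module := {f : prod_module | f \in sum_pred}.
HB.instance Definition _ := SubChoice.on sum_module.
HB.instance Definition _ := [SubChoice_isSubLmodule of sum_module by <:].
End ProductSum.

Definition module_iso (R : pzRingType) (M N : lmodType R) : Prop :=
  exists phi : {linear M -> N}, bijective phi.

Section MackeyHom.
Variables (R : comPzRingType) (G : topologicalGroupType).
Variables K H : groupClosed G.

Definition mackey_pred (g : G) : {pred G} := [predI K & conj_pred g H].

Lemma mackey_subl g : {subset mackey_pred g <= K}.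
Proof. by move=> x /andP[]. Qed.

Lemma mackey_subr g : {subset mackey_pred g <= conj_pred g H}.
Proof. by move=> x /andP[]. Qed.

Definition mackey_Hom (sigma : representation R K) (tau : representation R H)
    (g : G) : lmodType R :=
  Hom_module (res_rep (@mackey_subl g) sigma)
    (res_rep (@mackey_subr g) (conj_rep g tau)).
End MackeyHom.

(* Main.v *)
From HB Require Import structures.
Require Import Defs.
From mathcomp Require Import all_boot all_algebra finmap.
From mathcomp Require Import all_classical topology.

(* Since K is open, the functions delta v supported on K with value v at 1 lie
   in c-Ind_K^G sigma, and their translates span it; hence restriction along
   delta gives Hom_G(c-Ind_K^G sigma, W) = Hom_K(sigma, W) for every
   G-representation W. For W = Ind_H^G tau, a K-map F is determined by the
   values F v g^-1 with g in K\G/H, because G is the union of the sets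
   H g^-1 K, and the only constraint on v |-> F v g^-1 is equivariance under
   the intersection of K and gHg^-1. In the second part, finite generation of
   sigma makes F v supported on finitely many sets H g^-1 K, uniformly in v, and
   compactness of H\H g^-1 K gives the converse. *)

Set Implicit Arguments.
Unset Strict Implicit.
Unset Printing Implicit Defensive.

Import GRing.Theory.

Local Open Scope classical_set_scope.
Local Open Scope quotient_scope.
Local Open Scope ring_scope.

(** * Compactness by covers, and module isomorphisms *)

Lemma compact_cover_compact (T : topologicalType) (A : set T) :
  compact A -> cover_compact A.
Proof.
(* A point of [A] makes [T] a pointed space, to which [compact_cover] applies; the empty set is
   covered by the empty subfamily. *)
have [->|/set0P[x _]] := eqVneq A set0; last first.
  pose T' : ptopologicalType := HB.pack T (isPointed.Build T x).
  by move=> cA; have : @compact T' A := cA; rewrite compact_cover.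
by move=> _ I D f _ _; exists fset0.
Qed.

Lemma module_iso_bij (R : pzRingType) (M N : lmodType R) (phi : M -> N) :
  linear phi -> injective phi -> (forall y, exists x, phi x = y) ->
  module_iso M N.
Proof.
move=> phil phiI phiS.
pose L : {linear M -> N} := HB.pack phi (GRing.isLinear.Build R M N _ phi phil).
exists L; have [psi phiK] := choice phiS.
by exists psi => // x; apply: phiI; rewrite phiK.
Qed.

Lemma module_iso_trans (R : pzRingType) (M N P : lmodType R) :
  module_iso M N -> module_iso N P -> module_iso M P.
Proof.
move=> [f fbij] [g gbij]; exists (g \o f : {linear M -> P}).
exact: bij_comp.
Qed.

Lemma linear_sum (R : pzRingType) (M N : lmodType R) (phi : M -> N)
    (I : Type) (r : seq I) (E : I -> M) : linear phi ->
  phi (\sum_(i <- r) E i) = \sum_(i <- r) phi (E i).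
Proof.
move=> phil.
pose L : {linear M -> N} := HB.pack phi (GRing.isLinear.Build R M N _ phi phil).
exact: (raddf_sum L).
Qed.

Section Rep.
Variables (R : comPzRingType) (G : groupType).

Lemma rep_act0 (L : {pred G}) (V : representation R L) l :
  l \in L -> rep_act l (0 : V) = 0.
Proof.
move=> lL; have := @rep_linear _ _ _ V l lL (-1) 0 0.
by rewrite scaler0 addr0 scaleN1r addNr.
Qed.

Lemma rep_actVK (L : groupClosed G) (V : representation R L) l :
  l \in L -> cancel (@rep_act _ _ _ V l^-1%g) (rep_act l).
Proof. by move=> lL v; rewrite -rep_actM ?gpredV// mulgV rep_act1. Qed.

End Rep.

(** * Cosets and double cosets of an open subgroup *)

Section Cosets.
Variables (G : topologicalGroupType) (K : groupClosed G).
Hypothesis Kopen : open [set` K].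

Lemma open_subgroup_trans (U : {pred G}) :
  open_subgroup K U -> open_subgroup predT U.
Proof.
move=> [gU UK /open_subspaceP[V oV VU]]; apply/open_subgroupT; split=> //.
suff -> : [set` U] = V `&` [set` K] by exact: openI.
by rewrite VU; apply/esym/setIidl => x; exact: UK.
Qed.

Lemma open_translate (g : G) : open [set x | (x * g)%g \in K].
Proof.
apply: (@open_comp _ _ (fun x => (x * g)%g) [set` K]) => // x _.
exact: mulgr_continuous.
Qed.

Lemma open_dcoset (L : {pred G}) g : open (dcoset L g K).
Proof.
have -> : dcoset L g K =
    \bigcup_(l in [set` L]) [set x | ((l * g)^-1 * x)%g \in K].
  apply/seteqP; split=> [_ [l lL [k kK <-]]|x [l lL xK]].
    by exists l => //=; rewrite mulKg.
  by exists l => //; exists ((l * g)^-1 * x)%g => //; rewrite mulVKg.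
apply: bigcup_open => l _.
apply: (@open_comp _ _ (fun x => ((l * g)^-1 * x)%g) [set` K]) => // x _.
exact: mulgl_continuous.
Qed.

(** The preimage of [A] is a union of cosets K y, each a translate of the open set K. *)
Lemma rcoset_space_discrete (A : set (rcoset_space K)) : open A.
Proof.
rewrite to_rcoset_open.
have -> : to_rcoset K @^-1` A =
    \bigcup_(y in to_rcoset K @^-1` A) [set x | (x * y^-1)%g \in K].
  apply/seteqP; split=> [x Ax|x [y Ay /to_rcosetE xy]].
    by exists x => //=; rewrite mulgV gpred1.
  by rewrite /= xy.
by apply: bigcup_open => y _; exact: open_translate.
Qed.

Lemma compact_rcoset_finite (A : set (rcoset_space K)) :
  compact A -> finite_set A.
Proof.
move=> /compact_cover_compact/(_ _ A (fun q => [set q]))[q _||S _ AS].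
- exact: rcoset_space_discrete.
- by move=> q Aq; exists q.
apply: (sub_finite_set (B := [set` S])) => // q /AS[p pS ->] //.
Qed.

(** A double coset K g L is stable under K on the left, so membership can be tested in K\G. *)
Lemma dcoset_rcosetP (L : {pred G}) g x :
  (to_rcoset K @` dcoset K g L) (to_rcoset K x) <-> dcoset K g L x.
Proof.
split=> [[_ [k kK [l lL <-]] /to_rcosetE kx]|xKgL]; last by exists x.
exists (x / (k * g * l) * k)%g.
  by rewrite /= gpredM// -gpredV invgM invgK.
by exists l => //; rewrite -!mulgA !(mulgA k) mulgA mulgVK.
Qed.

Definition rcoset_repr (q : rcoset_space K) : G :=
  repr (q : {eq_quot (rcoset_rel K)}).

Lemma rcoset_reprK : cancel rcoset_repr (to_rcoset K).
Proof. by move=> q; exact: reprK. Qed.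

Lemma rcoset_reprP x : (x / rcoset_repr (to_rcoset K x))%g \in K.
Proof. by apply/to_rcosetE; rewrite rcoset_reprK. Qed.

End Cosets.

Lemma sub_predT (T : Type) (L : {pred T}) : {subset L <= (predT : {pred T})}.
Proof. by []. Qed.

Definition Hom_of (R : comPzRingType) (G : groupType) (L : {pred G})
    (V W : representation R L) (phi : V -> W)
    (h : phi \in Hom_pred (V:=V) (W:=W)) : Hom_module V W :=
  exist (fun psi : V -> W => psi \in Hom_pred (V:=V) (W:=W)) phi h.

(** * Frobenius reciprocity for compact induction from an open subgroup *)

Section Frobenius.
Variables (R : comPzRingType) (G : topologicalGroupType) (K : groupClosed G).
Hypothesis Kopen : open [set` K].
Variables (sigma : representation R K).
Variables (W : representation R (predT : {pred G})).
Hypothesis sigma_smooth : smooth sigma.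

Definition delta_fun (v : sigma) : G -> sigma :=
  fun x => if x \in K then rep_act x v else 0.

Lemma delta_cInd v : delta_fun v \in @cInd_pred R G K sigma.
Proof.
apply/cIndP; split.
  apply/IndP; split=> [h x hK|].
    rewrite /delta_fun gpredMl//; case: ifP => xK; last by rewrite rep_act0.
    by rewrite rep_actM.
  (* A stabiliser of [v] open in K is open in G, and since it lies in K its right translations
     preserve K and its complement. *)
  have [U [oU Uv]] := sigma_smooth v; have [_ UK _] := oU.
  exists U; split; first exact: open_subgroup_trans oU.
  move=> u uU; have uK := UK _ uU; apply/funext => x.
  rewrite /right_translate /delta_fun gpredMr//; case: ifP => // xK.
  by rewrite rep_actM// Uv.
have: to_rcoset K @` [set x | delta_fun v x != 0] `<=` [set to_rcoset K 1%g].
  move=> _ [x /= xv <-]; apply/to_rcosetE; rewrite invg1 mulg1.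
  by move: xv; rewrite /delta_fun; case: ifP; rewrite ?eqxx.
move=> /subset_set1[]; rewrite /compact_mod => ->; first exact: compact0.
exact: compact_set1.
Qed.

Definition delta (v : sigma) : cInd_module sigma :=
  exist (fun f : G -> sigma => f \in cInd_pred (V:=sigma)) _ (delta_cInd v).

Lemma delta_linear : linear delta.
Proof.
move=> a u v; apply/val_inj/funext => x; rewrite /= !fctE /delta_fun.
by case: ifP => xK; rewrite ?rep_linear// scaler0 addr0.
Qed.

Lemma delta_act k v : k \in K -> delta (rep_act k v) = cInd_act k (delta v).
Proof.
move=> kK; apply/val_inj/funext => x; rewrite /= /right_translate /delta_fun.
by rewrite gpredMr//; case: ifP => // xK; rewrite rep_actM.
Qed.

Definition rcoset_support (f : cInd_module sigma) : set (rcoset_space K) :=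
  [set q : rcoset_space K | val f (rcoset_repr q) != 0].

Lemma rcoset_support_finite (f : cInd_module sigma) :
  finite_set (rcoset_support f).
Proof.
have /cIndP[_ /(compact_rcoset_finite Kopen) fin] := valP f.
apply: sub_finite_set fin => q /= fq; exists (rcoset_repr q) => //.
exact: rcoset_reprK.
Qed.

Lemma cInd_act_val (f : cInd_module sigma) k x :
  k \in K -> val f (k * x)%g = rep_act k (val f x).
Proof. by move=> kK; have /cIndP[/IndP[If _] _] := valP f; exact: If. Qed.

Definition frobenius_term (F : sigma -> W) (f : cInd_module sigma)
    (q : rcoset_space K) : W :=
  rep_act (rcoset_repr q)^-1%g (F (val f (rcoset_repr q))).

(** The formula is forced: [f] is the sum over cosets K x of the translates by x^-1 of
    [delta (f x)], and [F] prescribes the values on [delta]. For linear [F] the terms vanish outside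
    the finite set [rcoset_support f]. *)
Definition frobenius_ext (F : sigma -> W) (f : cInd_module sigma) : W :=
  \sum_(q \in [set: rcoset_space K]) frobenius_term F f q.

Section Extension.
Variable F : sigma -> W.
Hypothesis Flin : linear F.
Hypothesis Fact : forall k v, k \in K -> F (rep_act k v) = rep_act k (F v).

(** The choice of representative is immaterial: replacing x by k x multiplies the value of [f] by k,
    which [F] lets through and (k x)^-1 cancels. *)
Lemma frobenius_termE f x :
  frobenius_term F f (to_rcoset K x) = rep_act x^-1%g (F (val f x)).
Proof.
rewrite /frobenius_term; set y := rcoset_repr _.
have kK : (x / y)%g \in K := rcoset_reprP K x.
have -> : x = ((x / y) * y)%g by rewrite mulgVK.
by rewrite cInd_act_val// Fact// -rep_actM// invgM mulgVK.
Qed.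

Let F0 : F 0 = 0.
Proof. by have := Flin (-1) 0 0; rewrite scaleN1r addNr scaleN1r addNr. Qed.

Lemma frobenius_term0 f q :
  val f (rcoset_repr q) = 0 -> frobenius_term F f q = 0.
Proof. by rewrite /frobenius_term => ->; rewrite F0 rep_act0. Qed.

Lemma frobenius_extE f (A : set (rcoset_space K)) :
  (rcoset_support f) `<=` A ->
  frobenius_ext F f = \sum_(q \in A) frobenius_term F f q.
Proof.
move=> fA; apply/esym/fsbig_widen => // q [_ Aq]; apply: frobenius_term0.
by apply: contrapT => /eqP /fA.
Qed.

Lemma frobenius_ext_linear : linear (frobenius_ext F).
Proof.
move=> a f1 f2.
(* One finite index set containing all three supports allows a comparison term by term. *)
pose A := rcoset_support f1 `|` rcoset_support f2.
have finA : finite_set A.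
  by rewrite finite_setU; split; exact: rcoset_support_finite.
have sub12 : rcoset_support (a *: f1 + f2) `<=` A.
  move=> q; rewrite /rcoset_support /= !fctE => f12.
  have [f1q|?] := eqVneq (val f1 (rcoset_repr q)) 0; last by left.
  by right; move: f12 => /=; rewrite f1q scaler0 add0r.
rewrite (frobenius_extE sub12) (@frobenius_extE f1 A); last by move=> q; left.
rewrite (@frobenius_extE f2 A); last by move=> q; right.
rewrite !fsbig_finite// scaler_sumr -big_split /=; apply: eq_bigr => q _.
by rewrite /frobenius_term /= !fctE Flin rep_linear.
Qed.

(** Right multiplication by [g] permutes K\G, and the term of the translate of [f] at K x is [g]
    applied to the term of [f] at K x g; the sum is reindexed along this permutation. *)
Lemma frobenius_ext_act g f :
  frobenius_ext F (cInd_act g f) = rep_act g (frobenius_ext F f).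
Proof.
pose t h (q : rcoset_space K) := to_rcoset K (rcoset_repr q * h)%g.
have tE h x : t h (to_rcoset K x) = to_rcoset K (x * h)%g.
  apply/to_rcosetE; rewrite invgM mulgA mulgK -gpredV invgM invgK.
  exact: rcoset_reprP.
have tK h : cancel (t h) (t h^-1%g).
  by move=> q; rewrite -[q]rcoset_reprK !tE mulgK.
have tb : bijective (t g) by exists (t g^-1%g) => // q; rewrite -{1}[g]invgK tK.
have termg q : frobenius_term F (cInd_act g f) q =
    rep_act g (frobenius_term F f (t g q)).
  rewrite -[q]rcoset_reprK tE !frobenius_termE /= /right_translate -rep_actM//.
  by rewrite invgM mulVKg.
have finA := rcoset_support_finite f.
rewrite /frobenius_ext; under eq_fsbigr do rewrite termg.
rewrite -(reindex_fsbigT _ (fun q => rep_act g (frobenius_term F f q)) tb).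
rewrite -/(frobenius_ext F f) (frobenius_extE (@subset_refl _ _)).
(* Linearity of the action moves [g] across finite sums only, so the index set is first cut down to
   the support. *)
rewrite -(@fsbig_widen _ _ _ _ (rcoset_support f))//.
  by rewrite !fsbig_finite// linear_sum//; exact: rep_linear.
move=> q [_ /negP]; rewrite negbK => /eqP fq.
by rewrite /= frobenius_term0// rep_act0.
Qed.

Lemma frobenius_ext_delta v : frobenius_ext F (delta v) = F v.
Proof.
rewrite (@frobenius_extE _ [set to_rcoset K 1%g]); last first.
  move=> q; rewrite /rcoset_support /= /delta_fun.
  case: ifP; rewrite ?eqxx// => qK _.
  by rewrite -[q]rcoset_reprK; apply/to_rcosetE; rewrite invg1 mulg1.
rewrite fsbig_set1 frobenius_termE /= /delta_fun gpred1 rep_act1.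
by rewrite invg1 rep_act1.
Qed.

End Extension.

(** Every [f] is a finite sum of translates of functions [delta v], so an equivariant linear map is
    determined by its values on these. *)
Lemma frobenius_ext_unique (Phi : cInd_module sigma -> W) : linear Phi ->
  (forall g f, Phi (cInd_act g f) = rep_act g (Phi f)) ->
  Phi = frobenius_ext (Phi \o delta).
Proof.
move=> Phil PhiG; apply/funext => f.
have Flin : linear (Phi \o delta) by move=> a u v; rewrite /= delta_linear Phil.
have finA := rcoset_support_finite f.
rewrite (frobenius_extE Flin (@subset_refl _ _)) fsbig_finite//.
transitivity (Phi (\sum_(q <- fset_set (rcoset_support f))
    cInd_act (rcoset_repr q)^-1%g (delta (val f (rcoset_repr q))))); last first.
  by rewrite linear_sum//; apply: eq_bigr => q _; rewrite PhiG.
congr Phi; apply/val_inj/funext => x; rewrite raddf_sum /= fct_sumE.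
transitivity (\sum_(q \in rcoset_support f)
    right_translate (rcoset_repr q)^-1%g (delta_fun (val f (rcoset_repr q))) x);
  last by rewrite fsbig_finite.
(* At the point [x] only the coset K x contributes, but it may lie outside the support of [f]; hence
   the sum is widened to all cosets before it is narrowed to that one. *)
rewrite (@fsbig_widen _ _ _ _ _ setT)//; last first.
  move=> q [_ /negP]; rewrite negbK => /eqP /= ->.
  by rewrite /right_translate /delta_fun; case: ifP => // ?; rewrite rep_act0.
rewrite -(@fsbig_widen _ _ _ _ [set to_rcoset K x])//; last first.
  move=> q [_ /= qx]; rewrite /right_translate /delta_fun; case: ifP => // xK.
  by case: qx; rewrite -[q]rcoset_reprK; apply/esym/to_rcosetE.
rewrite fsbig_set1 /= /right_translate /delta_fun rcoset_reprP.
by rewrite -cInd_act_val ?rcoset_reprP// mulgVK.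
Qed.

Theorem frobenius_reciprocity :
  module_iso (Hom_module (cInd sigma) W)
    (Hom_module sigma (res_rep (@sub_predT _ K) W)).
Proof.
have fP (Phi : Hom_module (cInd sigma) W) :
    (fun v => val Phi (delta v)) \in
      @Hom_pred _ _ _ sigma (res_rep (@sub_predT _ K) W).
  have /HomP[Pl PG] := valP Phi; apply/HomP; split.
    by move=> a u v; rewrite delta_linear Pl.
  by move=> k v kK; rewrite delta_act// -PG.
apply: (@module_iso_bij _ _ _ (fun Phi => Hom_of (fP Phi))).
- by move=> a P Q; apply/val_inj/funext.
- move=> P Q /(congr1 val) PQ; apply: val_inj.
  have /HomP[Pl PG] := valP P; have /HomP[Ql QG] := valP Q.
  rewrite (frobenius_ext_unique Pl); last by move=> g f; exact: PG.
  rewrite (frobenius_ext_unique Ql); last by move=> g f; exact: QG.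
  exact: congr1 PQ.
move=> F; have /HomP[Fl FK] := valP F.
have extP : frobenius_ext (val F) \in Hom_pred (V:=cInd sigma) (W:=W).
  apply/HomP; split; first exact: frobenius_ext_linear.
  by move=> g f _; exact: frobenius_ext_act.
exists (Hom_of extP); apply/val_inj/funext => v.
exact: frobenius_ext_delta.
Qed.

End Frobenius.

(** * Decomposition along the double cosets H g^-1 K *)

Section Mackey.
Variables (R : comPzRingType) (G : topologicalGroupType).
Variables H K : groupClosed G.
Variables (sigma : representation R K) (tau : representation R H).
Variable D : {pred G}.
Hypothesis Kopen : open [set` K].
Hypothesis sigma_smooth : smooth sigma.
Hypothesis Drep : dcoset_representatives K H D.

Let I := {g : G | g \in D}.

(** Inversion carries the double cosets K g H, represented by [D], to the sets H g^-1 K. *)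
Lemma dcoset_decomp x :
  exists h g k, [/\ h \in H, k \in K & x = (h * (val (g : I))^-1 * k)%g].
Proof.
have [g [[gD [k kK [h hH xE]]] _]] := Drep x^-1%g.
exists h^-1%g, (Sub g gD : I), k^-1%g; split; rewrite ?gpredV//.
by rewrite -[LHS]invgK -xE !invgM mulgA.
Qed.

Lemma dcoset_rep_inj (g g' : I) h h' k k' :
  h \in H -> h' \in H -> k \in K -> k' \in K ->
  (h * (val g)^-1 * k = h' * (val g')^-1 * k')%g -> g = g'.
Proof.
move=> hH h'H kK k'K e; apply: val_inj.
have [g0 [_ g0E]] := Drep (h * (val g)^-1 * k)^-1%g.
rewrite -(g0E (val g)) ?(g0E (val g')) //; split; try exact: valP.
  exists k'^-1%g; first by rewrite /= gpredV.
  by exists h'^-1%g; rewrite /= ?gpredV// e !invgM invgK mulgA.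
exists k^-1%g; first by rewrite /= gpredV.
by exists h^-1%g; rewrite /= ?gpredV// !invgM invgK mulgA.
Qed.

(** Common form of K-maps from [sigma] to [Ind tau] and to [cInd tau]. Smoothness of [F v] is not a
    field because it follows, by [intertwiner_Ind], from smoothness of [v]. *)
Record intertwiner (F : sigma -> G -> tau) : Prop := Intertwiner {
  intertwiner_linear : linear F;
  intertwiner_IND : forall v, IND (F v);
  intertwiner_act : forall k v x, k \in K -> F (rep_act k v) x = F v (x * k)%g
}.

Lemma intertwinerE F v h k x : intertwiner F -> h \in H -> k \in K ->
  F v (h * x * k)%g = rep_act h (F (rep_act k v) x).
Proof. by move=> [_ FI FK] hH kK; rewrite -mulgA FI// FK. Qed.

Lemma intertwiner_Ind F v : intertwiner F -> F v \in Ind_pred (V:=tau).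
Proof.
move=> [_ FI FK]; apply/IndP; split=> //.
have [U [oU Uv]] := sigma_smooth v; have [_ UK _] := oU.
exists U; split; first exact: open_subgroup_trans oU.
move=> u uU; apply/funext => x.
by rewrite /right_translate -FK ?Uv//; exact: UK.
Qed.

(** For l in K and in gHg^-1, g^-1 l = (g^-1 l g) g^-1 trades right translation by l for the action
    of an element of H. *)
Lemma intertwiner_Hom F g : intertwiner F ->
  (fun v => F v g^-1%g) \in Hom_pred
    (V := res_rep (@mackey_subl _ K H g) sigma)
    (W := res_rep (@mackey_subr _ K H g) (conj_rep g tau)).
Proof.
move=> [Fl FI FK]; apply/HomP; split.
  by move=> a u v; rewrite Fl.
move=> l v /andP[lK /conj_predV lH] /=.
by rewrite /conj_act -FI// FK// mulgK.
Qed.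

Definition mackey_component F (FP : intertwiner F) g : mackey_Hom sigma tau g :=
  Hom_of (intertwiner_Hom g FP).

Lemma intertwiner_ext F1 F2 : intertwiner F1 -> intertwiner F2 ->
  (forall v (g : I), F1 v (val g)^-1%g = F2 v (val g)^-1%g) -> F1 = F2.
Proof.
move=> F1P F2P F12; apply/funext => v; apply/funext => x.
have [h [g [k [hH kK ->]]]] := dcoset_decomp x.
by rewrite !intertwinerE// F12.
Qed.

Definition mackey_fun (g : G) (phi : mackey_Hom sigma tau g) : sigma -> tau :=
  val phi.

Lemma mackey_funP (g : G) (phi : mackey_Hom sigma tau g) :
  linear (mackey_fun phi) /\
  forall l v, l \in K -> (g^-1 * l * g)%g \in H ->
    mackey_fun phi (rep_act l v) =
      rep_act (g^-1 * l * g)%g (mackey_fun phi v).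
Proof.
have /HomP[phil phiL] := valP phi; split; first exact: phil.
move=> l v lK lH; have lM : l \in mackey_pred K H g;
  last exact: (phiL l v lM).
apply/andP; split=> //.
apply/conj_predP; exists (g^-1 * l * g)%g => //.
by rewrite !mulgA mulgV mul1g mulgK.
Qed.

(** The value of [F v] at h g^-1 k must be h applied to [phi g] of k v. This is independent of the
    decomposition, thanks to the equivariance of [phi g]. *)
Lemma mackey_glue (phi : forall g : I, mackey_Hom sigma tau (val g)) :
  exists F, intertwiner F /\
    forall v g, F v (val g)^-1%g = mackey_fun (phi g) v.
Proof.
have wd h h' (g g' : I) k k' v : h \in H -> h' \in H -> k \in K -> k' \in K ->
    (h * (val g)^-1 * k = h' * (val g')^-1 * k')%g ->
    rep_act h (mackey_fun (phi g) (rep_act k v)) =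
    rep_act h' (mackey_fun (phi g') (rep_act k' v)).
  move=> hH h'H kK k'K e; have gg' := dcoset_rep_inj hH h'H kK k'K e.
  case: _ / gg' in e *; have [_ phiL] := mackey_funP (phi g).
  (* The two decompositions differ by [k' * k^-1]; this identity places it in gHg^-1 as well as in
     K. *)
  have lE : ((val g)^-1 * (k' * k^-1) * val g = h'^-1 * h)%g.
    apply: (mulgI h'); rewrite mulVKg !mulgA -e.
    by rewrite mulgK mulgVK.
  have lH : ((val g)^-1 * (k' * k^-1) * val g)%g \in H.
    by rewrite lE gpredM ?gpredV.
  have lK : (k' * k^-1)%g \in K by rewrite gpredM ?gpredV.
  have -> : rep_act k' v = rep_act (k' * k^-1)%g (rep_act k v).
    by rewrite -rep_actM ?mulgVK.
  rewrite (phiL (k' * k^-1)%g)// lE rep_actM ?gpredV//.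
  by rewrite rep_actVK.
(* [F] is defined through one chosen decomposition of each [x]; [wd] then gives the formula [FE] for
   all decompositions. *)
have [d dE] := choice (fun x => let: ex_intro h (ex_intro g (ex_intro k e)) :=
  dcoset_decomp x in ex_intro (fun p : G * I * G => [/\ p.1.1 \in H, p.2 \in K &
    x = (p.1.1 * (val p.1.2)^-1 * p.2)%g]) (h, g, k) e).
pose F (v : sigma) x : tau :=
  rep_act (d x).1.1 (mackey_fun (phi (d x).1.2) (rep_act (d x).2 v)).
have FE v h g k : h \in H -> k \in K ->
    F v (h * (val g)^-1 * k)%g = rep_act h (mackey_fun (phi g) (rep_act k v)).
  by move=> hH kK; have [dH dK de] := dE (h * (val g)^-1 * k)%g; exact/esym/wd.
exists F; split; last first.
  move=> v g; have := FE v 1%g g 1%g (gpred1) (gpred1).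
  by rewrite mul1g mulg1 !rep_act1.
split.
- move=> a u v; apply/funext => x; rewrite !fctE /F.
  have [dH dK _] := dE x; have [phil _] := mackey_funP (phi (d x).1.2).
  by rewrite rep_linear// phil rep_linear.
- move=> v h' x h'H; have [h [g [k [hH kK ->]]]] := dcoset_decomp x.
  by rewrite !mulgA !FE ?gpredM// rep_actM.
move=> k' v x k'K; have [h [g [k [hH kK ->]]]] := dcoset_decomp x.
by rewrite -!(mulgA _ k) !FE ?gpredM// rep_actM.
Qed.

(** * Compact support modulo H against finitely many double cosets *)

Definition dcosets (A : set I) : set G :=
  \bigcup_(g in A) dcoset H (val g)^-1%g K.

(** The images of the sets H g^-1 K form an open cover of H\G, and finitely many suffice for the
    compact image of the support. *)
Lemma cInd_support_dcosets f : f \in cInd_pred (V:=tau) ->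
  exists2 A, finite_set A & [set x | f x != 0] `<=` dcosets A.
Proof.
move=> /cIndP[_ /compact_cover_compact].
move=> /(_ I setT (fun g => to_rcoset H @` dcoset H (val g)^-1%g K)).
case=> [g _||S _ fS].
- rewrite to_rcoset_open.
  suff -> : to_rcoset H @^-1` (to_rcoset H @` dcoset H (val g)^-1%g K) =
      dcoset H (val g)^-1%g K by exact: open_dcoset.
  by apply/seteqP; split=> x /dcoset_rcosetP.
- move=> _ [x _ <-]; have [h [g [k [hH kK xE]]]] := dcoset_decomp x.
  by exists g => //; exists x => //; exists h => //; exists k.
exists [set` S]; first exact: finite_fset.
move=> x fx; have [|g gS] := fS (to_rcoset H x); first by exists x.
by move=> /dcoset_rcosetP gx; exists g.
Qed.

(** A finite set [A] of double cosets that works for the generators works for all vectors, as those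
    [v] with [F v] vanishing off [A] form a subrepresentation. *)
Lemma intertwiner_finite_support F : finitely_generated sigma ->
  intertwiner F -> (forall v, F v \in cInd_pred (V:=tau)) ->
  finite_set [set g : I | exists v, F v (val g)^-1%g != 0].
Proof.
move=> [s gen] FP Fc.
have [A finA sA] : exists2 A, finite_set A &
    forall v, v \in s -> [set x | F v x != 0] `<=` dcosets A.
  elim: s {gen} => [|v s [A finA sA]]; first by exists set0.
  have [B finB vB] := cInd_support_dcosets (Fc v).
  exists (A `|` B); first by rewrite finite_setU.
  move=> w; rewrite inE => /predU1P[->|/sA wA] x => [/vB|/wA] [g gA xg].
    by exists g => //; right.
  by exists g => //; left.
(* Vanishing is required on all of g^-1 K, not just at g^-1, to make [W] stable under K. *)
pose W := [pred v : sigma | `[< forall g : I, ~ A g -> forall k, k \in K ->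
  F v ((val g)^-1 * k)%g = 0 >]].
have [Fl _ FK] := FP.
have WP v : v \in W.
  apply: gen v.
  - split=> [|a u v /asboolP uW /asboolP vW]; apply/asboolP => g gA k kK.
      by have := Fl (-1) 0 0; rewrite scaleN1r addNr scaleN1r addNr => ->.
    by rewrite Fl !fctE uW// vW// scaler0 addr0.
  - move=> l v lK /asboolP vW; apply/asboolP => g gA k kK.
    by rewrite FK// -mulgA vW// gpredM.
  move=> v vs; apply/asboolP => g gA k kK; apply: contrapT => /eqP.
  move=> /(sA v vs)[g' g'A [h hH [k' k'K e]]]; apply: gA.
  suff -> : g = g' by [].
  by apply: (@dcoset_rep_inj g g' 1%g h k k') => //; rewrite ?gpred1 ?mul1g.
apply: sub_finite_set finA => g [v]; apply: contra_neqP => gA.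
by have /asboolP/(_ g gA 1%g gpred1) := WP v; rewrite mulg1.
Qed.

(** The image of the support in H\G is closed and lies in a finite union of compact sets H\H g^-1
    K. *)
Lemma intertwiner_cInd F v :
  (forall g, compact (to_rcoset H @` dcoset H g K)) ->
  intertwiner F -> finite_set [set g : I | exists v, F v (val g)^-1%g != 0] ->
  F v \in cInd_pred (V:=tau).
Proof.
move=> cHK FP finF; apply/cIndP; split; first exact: intertwiner_Ind.
set A := [set g | _] in finF.
have cA : compact (\bigcup_(g in A) (to_rcoset H @` dcoset H (val g)^-1%g K)).
  rewrite -bigsetU_fset_set//; exact: bigsetU_compact.
apply: subclosed_compact cA _; first exact/support_closed/intertwiner_Ind.
move=> _ [x /= Fx <-]; move: Fx.
have [h [g [k [hH kK ->]]]] := dcoset_decomp x => Fx.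
exists g; last by exists (h / val g * k)%g => //; exists h => //; exists k.
(* The value of [F v] at h g^-1 k is h applied to that of [F (k v)] at g^-1, so the witness is k v
   rather than [v]. *)
exists (rep_act k v); apply: contra_neq Fx => Fx.
by rewrite intertwinerE// Fx rep_act0.
Qed.

(** * K-maps into [Ind tau] and [cInd tau] as a product and a direct sum *)

Lemma Hom_Ind_intertwiner
    (F : Hom_module sigma (res_rep (@sub_predT _ K) (Ind tau))) :
  intertwiner (fun v => val (val F v)).
Proof.
have /HomP[Fl FK] := valP F; split.
- by move=> a u v; rewrite Fl.
- by move=> v; have /IndP[] := valP (val F v).
- by move=> k v x kK; rewrite FK.
Qed.

Lemma Hom_cInd_intertwiner
    (F : Hom_module sigma (res_rep (@sub_predT _ K) (cInd tau))) :
  intertwiner (fun v => val (val F v)).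
Proof.
have /HomP[Fl FK] := valP F; split.
- by move=> a u v; rewrite Fl.
- by move=> v; have /cIndP[/IndP[]] := valP (val F v).
- by move=> k v x kK; rewrite FK.
Qed.

Lemma Hom_Ind_prod : module_iso
  (Hom_module sigma (res_rep (@sub_predT _ K) (Ind tau)))
  (prod_module (fun g : I => mackey_Hom sigma tau (val g))).
Proof.
apply: (@module_iso_bij _ _ _ (fun F => (fun g : I =>
  mackey_component (Hom_Ind_intertwiner F) (val g)) : prod_module _)).
- by move=> a F1 F2; apply/functional_extensionality_dep => g; exact: val_inj.
- move=> F1 F2 F12; apply/val_inj/funext => v; apply: val_inj.
  have e := intertwiner_ext (Hom_Ind_intertwiner F1) (Hom_Ind_intertwiner F2)
    (fun v g => congr1 (fun c : prod_module _ => mackey_fun (c g) v) F12).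
  exact: (congr1 (@^~ v) e).
move=> phi; have [F [FP Fphi]] := mackey_glue phi.
pose F' (v : sigma) : Ind_module tau :=
  exist (fun f : G -> tau => f \in Ind_pred (V:=tau)) _ (intertwiner_Ind v FP).
have F'P : F' \in Hom_pred (V:=sigma) (W:=res_rep (@sub_predT _ K) (Ind tau)).
  have [Fl _ FK] := FP; apply/HomP; split=> [a u v|k v kK]; apply: val_inj.
    exact: Fl.
  by apply/funext => x; exact: FK.
exists (Hom_of F'P); apply/functional_extensionality_dep => g.
by apply/val_inj/funext => v; exact: Fphi.
Qed.

Lemma Hom_cInd_sum :
  (forall g, compact (to_rcoset H @` dcoset H g K)) ->
  finitely_generated sigma ->
  module_iso
    (Hom_module sigma (res_rep (@sub_predT _ K) (cInd tau)))
    (sum_module (fun g : I => mackey_Hom sigma tau (val g))).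
Proof.
move=> cHK fg.
pose c (F : Hom_module sigma (res_rep (@sub_predT _ K) (cInd tau))) :=
  (fun g : I => mackey_component (Hom_cInd_intertwiner F) (val g)) :
    prod_module (fun g : I => mackey_Hom sigma tau (val g)).
have cP F : c F \in sum_pred (M:=fun g : I => mackey_Hom sigma tau (val g)).
  apply/asboolP; have := intertwiner_finite_support fg (Hom_cInd_intertwiner F)
    (fun v => valP (val F v)).
  apply: sub_finite_set => g /= cg; apply: contrapT => Fg.
  move/eqP: cg; apply; apply/val_inj/funext => v.
  by apply: contrapT => /eqP Fgv; apply: Fg; exists v.
apply: (@module_iso_bij _ _ _ (fun F => exist (fun f : prod_module _ =>
  f \in sum_pred (M:=fun g : I => mackey_Hom sigma tau (val g))) (c F) (cP F)
  : sum_module _)).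
- move=> a F1 F2; apply: val_inj.
  by apply/functional_extensionality_dep => g; exact: val_inj.
- move=> F1 F2 /(congr1 val) F12; apply/val_inj/funext => v; apply: val_inj.
  have e := intertwiner_ext (Hom_cInd_intertwiner F1) (Hom_cInd_intertwiner F2)
    (fun v g => congr1 (fun c : prod_module _ => mackey_fun (c g) v) F12).
  exact: (congr1 (@^~ v) e).
move=> phi; have [F [FP Fphi]] := mackey_glue (val phi).
(* Membership of [phi] in the direct sum bounds the support of [F v] uniformly in [v], so that the
   glued map takes values in [cInd tau]. *)
have finF : finite_set [set g : I | exists v, F v (val g)^-1%g != 0].
  have /asboolP := valP phi; apply: sub_finite_set => g /= [v].
  by apply: contra_neq => phig; rewrite Fphi (congr1 (@mackey_fun _) phig).
pose F' (v : sigma) : cInd_module tau :=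
  exist (fun f : G -> tau => f \in cInd_pred (V:=tau)) _
    (intertwiner_cInd v cHK FP finF).
have F'P : F' \in Hom_pred (V:=sigma) (W:=res_rep (@sub_predT _ K) (cInd tau)).
  have [Fl _ FK] := FP; apply/HomP; split=> [a u v|k v kK]; apply: val_inj.
    exact: Fl.
  by apply/funext => x; exact: FK.
exists (Hom_of F'P); apply/val_inj/functional_extensionality_dep => g.
by apply/val_inj/funext => v; exact: Fphi.
Qed.

End Mackey.

Theorem corollary2p7 (R : comPzRingType) (G : topologicalGroupType)
    (H K : groupClosed G)
    (sigma : representation R K) (tau : representation R H)
    (D : {pred G})
    (hG : locally_profinite G)
    (hH : closed [set` H]) (hK : open [set` K])
    (hsigma : smooth sigma) (htau : smooth tau)
    (hD : dcoset_representatives K H D) :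
  module_iso (Hom_module (cInd sigma) (Ind tau))
    (prod_module (fun g : {g : G | g \in D} => mackey_Hom sigma tau (val g)))
  /\
  ((forall g : G, compact (to_rcoset H @` dcoset H g K)) ->
   finitely_generated sigma ->
   module_iso (Hom_module (cInd sigma) (cInd tau))
     (sum_module (fun g : {g : G | g \in D} => mackey_Hom sigma tau (val g)))).
Proof.
split=> [|cHK fg]; apply: module_iso_trans.
- exact: frobenius_reciprocity.
- exact: Hom_Ind_prod.
- exact: frobenius_reciprocity.
- exact: Hom_cInd_sum.
Qed.
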